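(* The Poisson structures $e_1,e_2,e_3,e_4$ on $W_1=\mathrm{Tot}(\mathcal O_{\mathbb P^1}(-1)\oplus\mathcal O_{\mathbb P^1}(-1))$ specified in the context are all pairwise isomorphic.
   Context: $W_1$ is obtained by gluing $U=\mathbb C^3_{\{z,u_1,u_2\}}$ and $V=\mathbb C^3_{\{\xi,v_1,v_2\}}$ by $(\xi,v_1,v_2)=(z^{-1},zu_1,zu_2)$ where $z,\xi\ne0$. Write $\partial_0=\partial/\partial z$, $\partial_1=\partial/\partial u_1$, $\partial_2=\partial/\partial u_2$. The global holomorphic Poisson bivector fields $e_i$ on $W_1$ are those given on $U$ by $$e_1=\partial_2\wedge\partial_0,\quad e_2=\partial_0\wedge\partial_1,\quad e_3=u_1\,\partial_1\wedge\partial_2+z\,\partial_2\wedge\partial_0,\quad e_4=u_2\,\partial_1\wedge\partial_2+z\,\partial_0\wedge\partial_1 .$$ Two Poisson structures $\pi,\pi'$ on $W_1$ are isomorphic if there is a biholomorphism $\phi:W_1\to W_1$ with $\phi_*\pi=\pi'$. *)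

(* Defs.v *)
From HB Require Import structures.
From mathcomp Require Import all_boot all_order all_algebra.
From mathcomp Require Import generic_quotient complex ring.
From mathcomp Require Import all_classical all_reals all_analysis.

Set Implicit Arguments.
Unset Strict Implicit.
Unset Printing Implicit Defensive.

Import Order.TTheory GRing.Theory Num.Theory.
Import numFieldNormedType.Exports.

Local Open Scope classical_set_scope.
Local Open Scope ring_scope.
Local Open Scope quotient_scope.

(* The scalars form an arbitrary numFieldType K, so that the library's        *)
(* differential calculus applies as is; over K = R[i], where differentiable   *)
(* means C-differentiable, this is the complex manifold W_1.                  *)

(* A point x : 'rV[K]_3 of a chart has coordinates x 0 0, x 0 1, x 0 2, which *)
(* are (z, u_1, u_2) in U and (xi, v_1, v_2) in V.                            *)

Definition chart := bool.
Definition chartU : chart := true.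
Definition chartV : chart := false.

Section W1.
Variable K : numFieldType.

Definition point3 (a b c : K) : 'rV[K]_3 :=
  \row_j (if j == 0 then a else if j == 1 then b else c).

Definition glue (x : 'rV[K]_3) : 'rV[K]_3 :=
  point3 (x 0 0)^-1 (x 0 0 * x 0 1) (x 0 0 * x 0 2).

Definition glue_rel (p q : chart * 'rV[K]_3) : bool :=
  match p, q with
  | (true, x), (true, y) | (false, x), (false, y) => x == y
  | (true, x), (false, y) | (false, y), (true, x) =>
      (x 0 0 != 0) && (y == glue x)
  end.

Lemma ord3P (P : 'I_3 -> Prop) : P 0 -> P 1 -> P 2 -> forall i, P i.
Proof.
move=> P0 P1 P2 [[|[|[|//]]] lti].
- by rewrite (_ : Ordinal lti = 0) //; apply: val_inj.
- by rewrite (_ : Ordinal lti = 1) //; apply: val_inj.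
- by rewrite (_ : Ordinal lti = 2) //; apply: val_inj.
Qed.

Lemma point3E a b c : (point3 a b c 0 0 = a) * (point3 a b c 0 1 = b) *
  (point3 a b c 0 2 = c).
Proof. by rewrite !mxE. Qed.

Lemma row3P (x y : 'rV[K]_3) :
  x 0 0 = y 0 0 -> x 0 1 = y 0 1 -> x 0 2 = y 0 2 -> x = y.
Proof. by move=> e0 e1 e2; apply/rowP; apply: ord3P. Qed.

Lemma glueK (x : 'rV[K]_3) : x 0 0 != 0 -> glue (glue x) = x.
Proof.
move=> x0; apply: row3P; rewrite !point3E ?invrK //.
- by rewrite mulKf.
- by rewrite mulKf.
Qed.

Lemma glue_neq0 (x : 'rV[K]_3) : x 0 0 != 0 -> glue x 0 0 != 0.
Proof. by rewrite point3E invr_eq0. Qed.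

Lemma glue_inj (x y : 'rV[K]_3) : x 0 0 != 0 -> y 0 0 != 0 -> glue x = glue y -> x = y.
Proof. by move=> x0 y0 /(congr1 glue); rewrite !glueK. Qed.

Lemma glue_rel_refl : reflexive glue_rel.
Proof. by case=> -[] x /=. Qed.

Lemma glue_rel_sym : symmetric glue_rel.
Proof. by move=> [[] x] [[] y] //=; rewrite eq_sym. Qed.

Lemma glue_rel_trans : transitive glue_rel.
Proof.
move=> [[] y] [[] x] [[] z] //=.
- by move=> /eqP->.
- by move=> /eqP->.
- by move=> /andP[y0 /eqP->] /eqP <-; rewrite y0 /=.
- by move=> /andP[y0 /eqP->] /andP[_ /eqP->].
- move=> /andP[x0 /eqP->] /andP[z0 /eqP] /glue_inj.
  by move=> /(_ x0 z0)->.
- by move=> /andP[x0 /eqP->] /eqP <-; rewrite x0 /=.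
- by move=> /eqP->.
- by move=> /eqP->.
Qed.

Definition glue_equiv :=
  EquivRel glue_rel glue_rel_refl glue_rel_sym glue_rel_trans.

Definition W1 := {eq_quot glue_equiv}.

Definition param (a : chart) (x : 'rV[K]_3) : W1 := \pi_W1 (a, x).

(* In the coordinates a at p = param a x and b at phi p, the map phi is given *)
(* near x by a holomorphic f : K^3 -> K^3; continuity of phi is implied.      *)
Definition holomorphic (phi : W1 -> W1) : Prop :=
  forall (a : chart) (x : 'rV[K]_3), exists (b : chart) (f : 'rV[K]_3 -> 'rV[K]_3),
    \forall x' \near x, phi (param a x') = param b (f x') /\ differentiable f x'.

Definition biholomorphic (phi : W1 -> W1) : Prop :=
  holomorphic phi /\
  exists psi : W1 -> W1, [/\ cancel phi psi, cancel psi phi & holomorphic psi].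

(* A bivector sum_(i < j) pi^(ij) d_i /\ d_j is encoded by its antisymmetric  *)
(* coefficient matrix (pi^(ij)).                                              *)
Definition wedge (i j : 'I_3) : 'M[K]_3 := delta_mx i j - delta_mx j i.

(* The bivector (Lambda^2 df_x)(B) at f x; the library's Jacobian acts on row *)
(* vectors, ('d f x) v = v *m jacobian f x, whence the place of the transpose.*)
Definition push (f : 'rV[K]_3 -> 'rV[K]_3) (x : 'rV[K]_3) (B : 'M[K]_3)
  : 'M[K]_3 := (jacobian f x)^T *m B *m jacobian f x.

Definition partial (l : 'I_3) (g : 'rV[K]_3 -> K) (x : 'rV[K]_3) : K :=
  'D_(delta_mx 0 l) g x.

(* Coordinate (i, j, k) of the Schouten bracket [pi, pi], up to a universal   *)
(* nonzero factor.                                                            *)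
Definition schouten (pi : 'rV[K]_3 -> 'M[K]_3) (x : 'rV[K]_3) (i j k : 'I_3) : K :=
  \sum_(l < 3) (pi x i l * partial l (fun y => pi y j k) x
              + pi x j l * partial l (fun y => pi y k i) x
              + pi x k l * partial l (fun y => pi y i j) x).

Record poisson := Poisson {
  coef :> chart -> 'rV[K]_3 -> 'M[K]_3;
  coef_antisym : forall a x, (coef a x)^T = - coef a x;
  coef_holomorphic : forall a x, differentiable (coef a) x;
  coef_glue : forall x : 'rV[K]_3, x 0 0 != 0 ->
    push glue x (coef chartU x) = coef chartV (glue x);
  coef_poisson : forall a x i j k, schouten (coef a) x i j k = 0 }.

(* phi_* pi = pi', that is pi'_(phi p) = (Lambda^2 dphi_p)(pi_p) for every p, *)
(* in all charts a at p and b at phi p.                                       *)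
Definition pushforward_eq (phi : W1 -> W1) (pi pi' : poisson) : Prop :=
  forall (a b : chart) (x : 'rV[K]_3) (f : 'rV[K]_3 -> 'rV[K]_3),
    (\forall x' \near x, phi (param a x') = param b (f x')) ->
    differentiable f x ->
    push f x (pi a x) = pi' b (f x).

Definition poisson_isomorphic (pi pi' : poisson) : Prop :=
  exists phi : W1 -> W1, biholomorphic phi /\ pushforward_eq phi pi pi'.

Definition eU1 (x : 'rV[K]_3) : 'M[K]_3 := wedge 2 0.
Definition eU2 (x : 'rV[K]_3) : 'M[K]_3 := wedge 0 1.
Definition eU3 (x : 'rV[K]_3) : 'M[K]_3 :=
  x 0 1 *: wedge 1 2 + x 0 0 *: wedge 2 0.
Definition eU4 (x : 'rV[K]_3) : 'M[K]_3 :=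
  x 0 2 *: wedge 1 2 + x 0 0 *: wedge 0 1.

(* On V the e_i have, up to sign, the same expressions with the indices 1, 3  *)
(* and 2, 4 exchanged.                                                        *)
Definition on_charts (fU fV : 'rV[K]_3 -> 'M[K]_3) (a : chart) :=
  if a then fU else fun y => - fV y.

Lemma is_diff_coord (j : 'I_3) (x : 'rV[K]_3) :
  is_diff x (fun y : 'rV[K]_3 => y 0 j) (fun v : 'rV[K]_3 => v 0 j).
Proof.
have lin : linear (fun y : 'rV[K]_3 => y 0 j : K^o).
  by move=> a u v; rewrite !mxE.
pose L : {linear 'rV[K]_3 -> K^o} :=
  HB.pack (fun y : 'rV[K]_3 => y 0 j : K^o) (GRing.isLinear.Build _ _ _ _ _ lin).
apply: DiffDef; first exact: differentiable_coord.
exact: (@diff_lin _ _ _ L x (@coord_continuous _ _ _ _ _)).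
Qed.

Lemma is_diff_scale (W : normedModType K) (g dg : 'rV[K]_3 -> K) (w : W) x :
  is_diff x g dg -> is_diff x (fun y => g y *: w) (fun v => dg v *: w).
Proof.
move=> dgx; apply: DiffDef; first exact: differentiableZl.
by rewrite diffZl // diff_val.
Qed.

Lemma is_diff_sum3 (W : normedModType K) (g0 g1 g2 d0 d1 d2 : 'rV[K]_3 -> K)
    (c w0 w1 w2 : W) x :
  is_diff x g0 d0 -> is_diff x g1 d1 -> is_diff x g2 d2 ->
  is_diff x (fun y => c + (g0 y *: w0 + (g1 y *: w1 + g2 y *: w2)))
            (fun v => d0 v *: w0 + (d1 v *: w1 + d2 v *: w2)).
Proof.
move=> h0 h1 h2.
have k0 := is_diff_scale w0 h0; have k1 := is_diff_scale w1 h1.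
have k2 := is_diff_scale w2 h2.
have k := is_diffD (is_diff_cst c x) (is_diffD k0 (is_diffD k1 k2)).
by apply: (is_diff_eq k); apply/funext => v; exact: add0r.
Qed.

Definition affine (A B0 B1 B2 : 'M[K]_3) (x : 'rV[K]_3) : 'M[K]_3 :=
  A + (x 0 0 *: B0 + (x 0 1 *: B1 + x 0 2 *: B2)).

Lemma affine_differentiable A B0 B1 B2 x : differentiable (affine A B0 B1 B2) x.
Proof.
by have [] := is_diff_sum3 A B0 B1 B2
  (is_diff_coord 0 x) (is_diff_coord 1 x) (is_diff_coord 2 x).
Qed.

Lemma sum3E (V : nmodType) (F : 'I_3 -> V) : \sum_i F i = F 0 + (F 1 + F 2).
Proof.
rewrite !big_ord_recl big_ord0 addr0; congr (F _ + (F _ + F _)).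
- exact: val_inj.
- exact: val_inj.
Qed.

Lemma affine_partial A B0 B1 B2 j k l x :
  partial l (fun y => affine A B0 B1 B2 y j k) x =
  if l == 0 then B0 j k else if l == 1 then B1 j k else B2 j k.
Proof.
have -> : (fun y => affine A B0 B1 B2 y j k) = fun y => A j k +
    (y 0 0 *: (B0 j k : K^o) + (y 0 1 *: (B1 j k : K^o) + y 0 2 *: (B2 j k : K^o))).
  by apply/funext => y; rewrite !mxE.
have d := is_diff_sum3 (A j k : K^o) (B0 j k : K^o) (B1 j k : K^o) (B2 j k : K^o)
  (is_diff_coord 0 x) (is_diff_coord 1 x) (is_diff_coord 2 x).
rewrite /partial deriveE; last exact: ex_diff.
rewrite diff_val !mxE; elim/ord3P: l => /=;
  by rewrite ?(scale1r, scale0r, addr0, add0r).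
Qed.

Lemma jacobian_glue (x : 'rV[K]_3) : x 0 0 != 0 ->
  jacobian glue x = \matrix_(i < 3, j < 3)
    (if i == 0 then (if j == 0 then - (x 0 0) ^- 2 else x 0 j)
     else if i == j then x 0 0 else 0).
Proof.
move=> x0.
have glueE : glue = fun y => 0 + ((y 0 0)^-1 *: delta_mx 0 0 +
    ((y 0 0 * y 0 1) *: delta_mx 0 1 + (y 0 0 * y 0 2) *: delta_mx 0 2)).
  by apply/funext => y; apply: row3P; rewrite !mxE /=;
    rewrite ?(mulr0, mulr1, addr0, add0r).
have d0 := is_diff_coord 0 x.
have dV : is_diff x (fun y : 'rV[K]_3 => (y 0 0)^-1)
    (fun v : 'rV[K]_3 => - (x 0 0) ^- 2 * v 0 0).
  have dc := @ex_diff _ _ _ _ _ _ _ d0.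
  apply: DiffDef; first exact: (differentiableV dc x0).
  by rewrite (diffV dc x0) diff_val.
have d1 := is_diffM d0 (is_diff_coord 1 x).
have d2 := is_diffM d0 (is_diff_coord 2 x).
have d := is_diff_sum3 (0 : 'rV[K]_3) (delta_mx 0 0 : 'rV[K]_3)
  (delta_mx 0 1 : 'rV[K]_3) (delta_mx 0 2 : 'rV[K]_3) dV d1 d2.
apply/matrixP => i j; rewrite /jacobian glueE !mxE.
rewrite (@diff_val _ _ _ _ _ _ _ d) !mxE.
by elim/ord3P: i; elim/ord3P: j; rewrite ?fctE !mxE /=;
  rewrite ?(mulr0, mulr1, addr0, add0r, scaler0) /=; first [ring | exact: mulr1].
Qed.

Lemma eU1_affine : eU1 = affine (wedge 2 0) 0 0 0.
Proof. by apply/funext => x; rewrite /affine !scaler0 !addr0. Qed.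

Lemma eU2_affine : eU2 = affine (wedge 0 1) 0 0 0.
Proof. by apply/funext => x; rewrite /affine !scaler0 !addr0. Qed.

Lemma eU3_affine : eU3 = affine 0 (wedge 2 0) (wedge 1 2) 0.
Proof. by apply/funext => x; rewrite /affine scaler0 addr0 add0r addrC. Qed.

Lemma eU4_affine : eU4 = affine 0 (wedge 0 1) 0 (wedge 1 2).
Proof. by apply/funext => x; rewrite /affine scaler0 !add0r addrC. Qed.

Definition eU_affine := (eU1_affine, eU2_affine, eU3_affine, eU4_affine).

Lemma affineN A B0 B1 B2 :
  (fun y => - affine A B0 B1 B2 y) = affine (- A) (- B0) (- B1) (- B2).
Proof. by apply/funext => x; rewrite /affine !scalerN !opprD. Qed.

Lemma schouten_affine A B0 B1 B2 x i j k :
  let f := affine A B0 B1 B2 in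
  schouten f x i j k =
    (f x i 0 * B0 j k + f x j 0 * B0 k i + f x k 0 * B0 i j)
  + ((f x i 1 * B1 j k + f x j 1 * B1 k i + f x k 1 * B1 i j)
  + (f x i 2 * B2 j k + f x j 2 * B2 k i + f x k 2 * B2 i j)).
Proof. by rewrite /schouten sum3E /= !affine_partial. Qed.

Lemma schoutenN A B0 B1 B2 x i j k :
  let f := affine A B0 B1 B2 in
  schouten (fun y => - f y) x i j k = schouten f x i j k.
Proof. by rewrite /= affineN !schouten_affine -affineN !mxE; ring. Qed.

Lemma schouten_eU1 x i j k : schouten eU1 x i j k = 0.
Proof.
rewrite eU_affine schouten_affine !mxE.
by elim/ord3P: i; elim/ord3P: j; elim/ord3P: k; rewrite /=; ring.
Qed.

Lemma schouten_eU2 x i j k : schouten eU2 x i j k = 0.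
Proof.
rewrite eU_affine schouten_affine !mxE.
by elim/ord3P: i; elim/ord3P: j; elim/ord3P: k; rewrite /=; ring.
Qed.

Lemma schouten_eU3 x i j k : schouten eU3 x i j k = 0.
Proof.
rewrite eU_affine schouten_affine !mxE.
by elim/ord3P: i; elim/ord3P: j; elim/ord3P: k; rewrite /=; ring.
Qed.

Lemma schouten_eU4 x i j k : schouten eU4 x i j k = 0.
Proof.
rewrite eU_affine schouten_affine !mxE.
by elim/ord3P: i; elim/ord3P: j; elim/ord3P: k; rewrite /=; ring.
Qed.

Lemma wedge_tr i j : (wedge i j)^T = - wedge i j.
Proof. by rewrite /wedge linearB /= !trmx_delta opprB. Qed.

Definition affine_poisson (f : 'rV[K]_3 -> 'M[K]_3) :=
  [/\ forall x, (f x)^T = - f x, exists A B0 B1 B2, f = affine A B0 B1 B2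
    & forall x i j k, schouten f x i j k = 0].

Lemma eU1_poisson : affine_poisson eU1.
Proof.
split; [|by do 4!eexists; exact: eU1_affine|exact: schouten_eU1].
by move=> x; exact: wedge_tr.
Qed.

Lemma eU2_poisson : affine_poisson eU2.
Proof.
split; [|by do 4!eexists; exact: eU2_affine|exact: schouten_eU2].
by move=> x; exact: wedge_tr.
Qed.

Lemma eU3_poisson : affine_poisson eU3.
Proof.
split; [|by do 4!eexists; exact: eU3_affine|exact: schouten_eU3].
by move=> x; rewrite /eU3 linearD /= !linearZ /= !wedge_tr !scalerN opprD.
Qed.

Lemma eU4_poisson : affine_poisson eU4.
Proof.
split; [|by do 4!eexists; exact: eU4_affine|exact: schouten_eU4].
by move=> x; rewrite /eU4 linearD /= !linearZ /= !wedge_tr !scalerN opprD.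
Qed.

Lemma push_eU1 (x : 'rV[K]_3) :
  x 0 0 != 0 -> push glue x (eU1 x) = - eU3 (glue x).
Proof.
move=> x0; rewrite /push jacobian_glue //; apply/matrixP => i j.
rewrite !mxE !sum3E !mxE !sum3E !mxE /=.
by elim/ord3P: i; elim/ord3P: j; rewrite /=; field.
Qed.

Lemma push_eU2 (x : 'rV[K]_3) :
  x 0 0 != 0 -> push glue x (eU2 x) = - eU4 (glue x).
Proof.
move=> x0; rewrite /push jacobian_glue //; apply/matrixP => i j.
rewrite !mxE !sum3E !mxE !sum3E !mxE /=.
by elim/ord3P: i; elim/ord3P: j; rewrite /=; field.
Qed.

Lemma push_eU3 (x : 'rV[K]_3) :
  x 0 0 != 0 -> push glue x (eU3 x) = - eU1 (glue x).
Proof.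
move=> x0; rewrite /push jacobian_glue //; apply/matrixP => i j.
rewrite !mxE !sum3E !mxE !sum3E !mxE /=.
by elim/ord3P: i; elim/ord3P: j; rewrite /=; field.
Qed.

Lemma push_eU4 (x : 'rV[K]_3) :
  x 0 0 != 0 -> push glue x (eU4 x) = - eU2 (glue x).
Proof.
move=> x0; rewrite /push jacobian_glue //; apply/matrixP => i j.
rewrite !mxE !sum3E !mxE !sum3E !mxE /=.
by elim/ord3P: i; elim/ord3P: j; rewrite /=; field.
Qed.

Section FromCharts.
Variables fU fV : 'rV[K]_3 -> 'M[K]_3.
Hypotheses (PU : affine_poisson fU) (PV : affine_poisson fV).
Hypothesis push_fU :
  forall x : 'rV[K]_3, x 0 0 != 0 -> push glue x (fU x) = - fV (glue x).

Lemma on_charts_antisym a x : (on_charts fU fV a x)^T = - on_charts fU fV a x.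
Proof.
have [tU _ _] := PU; have [tV _ _] := PV.
by case: a; rewrite //= linearN /= tV.
Qed.

Lemma on_charts_holomorphic a x : differentiable (on_charts fU fV a) x.
Proof.
have [_ [A [B0 [B1 [B2 hU]]]] _] := PU; have [_ [A' [B0' [B1' [B2' hV]]]] _] := PV.
by case: a; rewrite /= ?hU ?hV ?affineN; exact: affine_differentiable.
Qed.

Lemma on_charts_poisson a x i j k : schouten (on_charts fU fV a) x i j k = 0.
Proof.
have [_ _ sU] := PU; have [_ [A [B0 [B1 [B2 hV]]]] sV] := PV.
by case: a => //=; rewrite hV schoutenN -hV.
Qed.

Definition from_charts : poisson := @Poisson (on_charts fU fV)
  on_charts_antisym on_charts_holomorphic push_fU on_charts_poisson.

End FromCharts.

Definition e1 : poisson := from_charts eU1_poisson eU3_poisson push_eU1.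
Definition e2 : poisson := from_charts eU2_poisson eU4_poisson push_eU2.
Definition e3 : poisson := from_charts eU3_poisson eU1_poisson push_eU3.
Definition e4 : poisson := from_charts eU4_poisson eU2_poisson push_eU4.

Definition e (k : 'I_4) : poisson := tnth [tuple e1; e2; e3; e4] k.

End W1.

(* Main.v *)
From mathcomp Require Import all_boot all_order all_algebra.
From mathcomp Require Import generic_quotient complex ring.
From mathcomp Require Import all_classical all_reals all_analysis.
Require Import Defs.

(** The isomorphisms come from two obvious symmetries of the bundle W_1 over
    the projective line.  A constant invertible matrix acting on the fibre
    coordinates commutes with the gluing map, hence acts on W_1; and since the
    gluing map is an involution with the same expression in both directions,
    exchanging the charts U and V is a symmetry as well.  So every such matrix
    M, together with a bit c telling whether the charts are exchanged, induces
    a biholomorphism [chart_map c M] of W_1 that is x |-> x *m M in coordinates.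

    The rotation (u_1, u_2) |-> (- u_2, u_1) of the fibres sends d_2 to - d_1,
    d_1 to d_2, and therefore e_1 to e_2 and e_3 to e_4.  In the chart V the
    structures e_1 and e_3 read - e_3 and - e_1, so exchanging the charts
    carries e_1 to e_3 up to a sign, and the reflection u_2 |-> - u_2 of the
    fibres absorbs this sign.

    What has to be checked is that a chart-wise identity between coefficient
    matrices gives a pushforward in the intrinsic sense, which allows arbitrary
    charts at the source and at the target ([chart_map_pushforward]): a local
    expression of the map is either x |-> x *m M or its composite with the
    gluing map, and the Poisson structures are compatible with the gluing in
    both directions ([push_glue]).  Chart-wise linear isomorphy is an
    equivalence relation by matrix algebra alone, so the two symmetries
    suffice to connect all four structures. *)

Set Implicit Arguments.
Unset Strict Implicit.
Unset Printing Implicit Defensive.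

Import Order.TTheory GRing.Theory Num.Theory.
Import numFieldNormedType.Exports.

Local Open Scope classical_set_scope.
Local Open Scope ring_scope.
Local Open Scope quotient_scope.

(** * Equality of points given in charts *)

Lemma param_inj (K : numFieldType) a : injective (@param K a).
Proof. by move=> x y /eqquotP; case: a => /eqP. Qed.

Lemma param_glue (K : numFieldType) a (x : 'rV[K]_3) :
  x 0 0 != 0 -> param a x = param (~~ a) (glue x).
Proof.
move=> x0; apply/eqquotP; case: a => /=; rewrite ?x0 ?eqxx //.
by rewrite glue_neq0 ?glueK ?eqxx.
Qed.

Lemma param_eqN (K : numFieldType) a (x y : 'rV[K]_3) :
  param a x = param (~~ a) y -> x 0 0 != 0 /\ y = glue x.
Proof.
move=> /eqquotP; case: a => /= /andP[] => [x0 /eqP //|y0 /eqP ->].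
by rewrite glue_neq0 ?glueK ?eqxx.
Qed.

(** * Pushing bivectors forward *)

Lemma differentiable_glue (K : numFieldType) (x : 'rV[K]_3) :
  x 0 0 != 0 -> differentiable (@glue K) x.
Proof.
move=> x0.
have -> : @glue K = fun y => 0 + ((y 0 0)^-1 *: delta_mx 0 0 +
    ((y 0 0 * y 0 1) *: delta_mx 0 1 + (y 0 0 * y 0 2) *: delta_mx 0 2)).
  by apply/funext => y; apply: row3P; rewrite !mxE /=;
    rewrite ?(mulr0, mulr1, addr0, add0r).
have d0 := is_diff_coord 0 x.
have dV : is_diff x (fun y : 'rV[K]_3 => (y 0 0)^-1)
    ('d (fun y : 'rV[K]_3 => (y 0 0)^-1) x).
  by apply: DiffDef => //; apply: differentiableV.
have d1 := is_diffM d0 (is_diff_coord 1 x).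
have d2 := is_diffM d0 (is_diff_coord 2 x).
by have [] := is_diff_sum3 (0 : 'rV[K]_3) (delta_mx 0 0 : 'rV[K]_3)
  (delta_mx 0 1 : 'rV[K]_3) (delta_mx 0 2 : 'rV[K]_3) dV d1 d2.
Qed.

Lemma mulmx_row3 (K : numFieldType) (x : 'rV[K]_3) (M : 'M[K]_3) :
  x *m M = 0 + (x 0 0 *: row 0 M + (x 0 1 *: row 1 M + x 0 2 *: row 2 M)).
Proof. by apply/rowP => j; rewrite !mxE sum3E add0r. Qed.

Lemma is_diff_mulmx (K : numFieldType) (M : 'M[K]_3) (x : 'rV[K]_3) :
  is_diff x (fun y : 'rV[K]_3 => y *m M) (fun v => v *m M).
Proof.
have d := is_diff_sum3 (0 : 'rV[K]_3) (row 0 M) (row 1 M) (row 2 M)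
  (is_diff_coord 0 x) (is_diff_coord 1 x) (is_diff_coord 2 x).
have -> : (fun y : 'rV[K]_3 => y *m M) =
    fun y => 0 + (y 0 0 *: row 0 M + (y 0 1 *: row 1 M + y 0 2 *: row 2 M)).
  by apply/funext => y; exact: mulmx_row3.
by apply: (is_diff_eq d); apply/funext => y; rewrite add0r.
Qed.

Lemma jacobian_mulmx (K : numFieldType) (M : 'M[K]_3) (x : 'rV[K]_3) :
  jacobian (fun y : 'rV[K]_3 => y *m M) x = M.
Proof.
apply/row_matrixP => i; rewrite rowE [RHS]rowE /jacobian mul_rV_lin1.
by rewrite (@diff_val _ _ _ _ _ _ _ (is_diff_mulmx M x)).
Qed.

Lemma row_jacobian (K : numFieldType) (f : 'rV[K]_3 -> 'rV[K]_3) x i :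
  differentiable f x -> row i (jacobian f x) = 'D_(delta_mx 0 i) f x.
Proof. by move=> df; rewrite rowE (deriveEjacobian (delta_mx 0 i) df). Qed.

(** The pushforward at x depends only on the germ of the map at x, because the
    rows of the Jacobian are directional derivatives. *)
Lemma near_eq_push (K : numFieldType) (f g : 'rV[K]_3 -> 'rV[K]_3) x B :
  differentiable f x -> differentiable g x -> (\near x, f x = g x) ->
  push f x B = push g x B.
Proof.
move=> df dg fg; rewrite /push; suff -> : jacobian f x = jacobian g x by [].
apply/row_matrixP => i.
apply: (etrans (row_jacobian i df)); apply: (etrans _ (esym (row_jacobian i dg))).
exact: near_eq_derive.
Qed.

Lemma push_comp (K : numFieldType) (f g : 'rV[K]_3 -> 'rV[K]_3) x B :
  differentiable f x -> differentiable g (f x) ->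
  push (g \o f) x B = push g (f x) (push f x B).
Proof.
move=> df dg; rewrite /push.
suff -> : jacobian (g \o f) x = jacobian f x *m jacobian g (f x).
  by rewrite trmx_mul !mulmxA.
have jacE (h : 'rV[K]_3 -> 'rV[K]_3) y v : v *m jacobian h y = 'd h y v.
  exact: mul_rV_lin1.
apply/row_matrixP => i.
apply: (etrans (rowE _ _)).
apply: (etrans (jacE (g \o f) x _)).
apply: (etrans _ (esym (rowE _ _))); apply: (etrans _ (esym (mulmxA _ _ _))).
by rewrite diff_comp //= jacE jacE.
Qed.

Lemma push_mulmx (K : numFieldType) (M : 'M[K]_3) x B :
  push (fun y : 'rV[K]_3 => y *m M) x B = M^T *m B *m M.
Proof. by rewrite /push jacobian_mulmx. Qed.

Lemma near_neq0 (K : numFieldType) (x : 'rV[K]_3) :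
  x 0 0 != 0 -> \forall y \near x, (y : 'rV[K]_3) 0 0 != 0.
Proof.
move=> x0; have c : {for x, continuous (fun y : 'rV[K]_3 => y 0 0)}.
  exact: (@coord_continuous K 1 3 0 0 x).
exact: (cvgr_neq0 (x 0 0) c x0).
Qed.

(** From U to V this is part of the definition of a Poisson structure.  From V
    to U it follows by functoriality of the pushforward: glue is an involution
    near y = glue x, so pushing along glue twice is the identity. *)
Lemma push_glue (K : numFieldType) (pi : poisson K) a (x : 'rV[K]_3) :
  x 0 0 != 0 -> push (@glue K) x (pi a x) = pi (~~ a) (glue x).
Proof.
case: a => x0; first exact: coef_glue.
move: (glue_neq0 x0) (glueK x0); set y := glue x => y0 yK.
have dx : differentiable (@glue K) (glue y).
  by apply: differentiable_glue; rewrite yK.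
have dy := differentiable_glue y0; have dyy := differentiable_comp dy dx.
have d1 : differentiable (fun u : 'rV[K]_3 => u *m 1%:M) y.
  by have [] := is_diff_mulmx 1%:M y.
have nE : \near y, (@glue K \o @glue K) y = y *m 1%:M.
  by near do rewrite /= mulmx1 glueK //; exact: near_neq0.
have := push_comp (coef pi chartU y) dy dx.
rewrite (near_eq_push _ dyy d1 nE) push_mulmx trmx1 mulmx1 mul1mx (coef_glue pi y0).
by rewrite yK => ->.
Unshelve. all: by end_near. Qed.

(** * Symmetries of the bundle that are linear in the charts *)

Definition fibrewise (K : numFieldType) (M : 'M[K]_3) : Prop :=
  forall x : 'rV[K]_3, (x *m M) 0 0 = x 0 0 /\
    (x 0 0 != 0 -> glue (x *m M) = glue x *m M).

Lemma fibrewiseM (K : numFieldType) (M N : 'M[K]_3) :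
  fibrewise M -> fibrewise N -> fibrewise (M *m N).
Proof.
move=> fM fN x; rewrite mulmxA.
have [z1 g1] := fM x; have [z2 g2] := fN (x *m M).
split; first by rewrite z2 z1.
by move=> x0; rewrite g2 ?z1 // g1 // mulmxA.
Qed.

Definition chart_map (K : numFieldType) (c : bool) (M : 'M[K]_3) (w : W1 K) :
    W1 K :=
  param (c (+) (repr w).1) ((repr w).2 *m M).

(** [chart_map] is computed on the canonical representative of a class; a
    matrix commuting with the gluing makes the choice of representative
    irrelevant. *)
Lemma chart_mapE (K : numFieldType) c (M : 'M[K]_3) a x : fibrewise M ->
  chart_map c M (param a x) = param (c (+) a) (x *m M).
Proof.
move=> fM; rewrite /chart_map.
have: param (repr (param a x)).1 (repr (param a x)).2 = param a x.
  by rewrite /param -surjective_pairing reprK.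
case: (repr _) => a' x' /=; have [<- /param_inj -> //|na] := eqVneq a' a.
have -> : a = ~~ a' by case: a a' na => [] [].
move=> /param_eqN[x'0 ->]; have [z g] := fM x'.
by rewrite param_glue ?z // g // -addbN.
Qed.

Lemma chart_map_holomorphic (K : numFieldType) c (M : 'M[K]_3) :
  fibrewise M -> holomorphic (chart_map c M).
Proof.
move=> fM a x; exists (c (+) a), (fun y : 'rV[K]_3 => y *m M).
near=> y; split; first exact: chart_mapE.
by have [] := is_diff_mulmx M y.
Unshelve. all: by end_near. Qed.

Lemma chart_mapK (K : numFieldType) c (M N : 'M[K]_3) : fibrewise M ->
  fibrewise N -> M *m N = 1%:M -> cancel (chart_map c M) (chart_map c N).
Proof.
move=> fM fN MN w; have <- : param (repr w).1 (repr w).2 = w.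
  by rewrite /param -surjective_pairing reprK.
by rewrite !chart_mapE // -mulmxA MN mulmx1 addbA addbb.
Qed.

(** If f expresses the map from a to b near x, then either b is the chart
    c (+) a, and injectivity of the parametrization forces f to be x |-> x *m M
    near x, or b is the other chart, and f is that map followed by glue. *)
Lemma chart_map_pushforward (K : numFieldType) c (M : 'M[K]_3)
    (pi pi' : poisson K) : fibrewise M ->
  (forall a x, M^T *m pi a x *m M = pi' (c (+) a) (x *m M)) ->
  pushforward_eq (chart_map c M) pi pi'.
Proof.
move=> fM H a b x f nf df.
have dM : differentiable (fun y : 'rV[K]_3 => y *m M) x.
  by have [] := is_diff_mulmx M x.
have nf' : \forall y \near x, param (c (+) a) (y *m M) = param b (f y).
  by apply: filterS nf => y; rewrite chart_mapE.
have [eb|nb] := eqVneq b (c (+) a).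
  have fE : \forall y \near x, f y = y *m M.
    by apply: filterS nf' => y; rewrite eb => /param_inj.
  by rewrite (near_eq_push _ df dM fE) push_mulmx H (nbhs_singleton fE) eb.
have eb : b = ~~ (c (+) a) by case: b (c (+) a) nb {nf nf'} => [] [].
have fE : \forall y \near x, f y = (@glue K \o (fun y => y *m M)) y.
  by apply: filterS nf' => y; rewrite eb => /param_eqN[].
have [x0 _] : (x *m M) 0 0 != 0 /\ f x = glue (x *m M).
  by apply: (@param_eqN _ (c (+) a)); rewrite -eb; exact: nbhs_singleton nf'.
have dg := differentiable_glue x0.
rewrite (near_eq_push _ df _ fE); last exact: differentiable_comp.
by rewrite push_comp // push_mulmx H push_glue // (nbhs_singleton fE) eb.
Qed.

(** Pairs (c, M) compose and invert by matrix algebra, with no analysis, which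
    is why the equivalence relation is established at this level and not for
    [poisson_isomorphic]. *)
Definition linearly_isomorphic (K : numFieldType) (pi pi' : poisson K) : Prop :=
  exists (c : bool) (M N : 'M[K]_3),
    [/\ fibrewise M, fibrewise N, M *m N = 1%:M
      & forall a x, M^T *m pi a x *m M = pi' (c (+) a) (x *m M)].

Lemma linearly_isomorphicW (K : numFieldType) (pi pi' : poisson K) :
  linearly_isomorphic pi pi' -> poisson_isomorphic pi pi'.
Proof.
move=> [c [M [N [fM fN MN H]]]]; exists (chart_map c M); split; last first.
  exact: chart_map_pushforward.
split; first exact: chart_map_holomorphic.
exists (chart_map c N); split; [exact: chart_mapK| |exact: chart_map_holomorphic].
by apply: chart_mapK => //; exact: mulmx1C.
Qed.

Lemma linearly_isomorphic_sym (K : numFieldType) (pi pi' : poisson K) :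
  linearly_isomorphic pi pi' -> linearly_isomorphic pi' pi.
Proof.
move=> [c [M [N [fM fN MN H]]]]; have NM := mulmx1C MN.
exists c, N, M; split=> // a x.
have := H (c (+) a) (x *m N); rewrite addbA addbb /= -(mulmxA x) NM mulmx1 => <-.
by rewrite !mulmxA -trmx_mul MN trmx1 mul1mx -mulmxA MN mulmx1.
Qed.

Lemma linearly_isomorphic_trans (K : numFieldType) (pi1 pi2 pi3 : poisson K) :
  linearly_isomorphic pi1 pi2 -> linearly_isomorphic pi2 pi3 ->
  linearly_isomorphic pi1 pi3.
Proof.
move=> [c [M [N [fM fN MN H]]]] [d [P [Q [fP fQ PQ G]]]].
exists (d (+) c), (M *m P), (Q *m N); split; [exact: fibrewiseM..| |].
  by rewrite mulmxA -(mulmxA M) PQ mulmx1.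
move=> a x; rewrite -addbA (mulmxA x) -G -H trmx_mul.
by rewrite !mulmxA.
Qed.

(** * The symmetries relating the four structures *)

(** The block matrix with blocks 1 and A = [a, b; c, d]; since coordinates are
    row vectors, it sends (u_1, u_2) to (a u_1 + c u_2, b u_1 + d u_2). *)
Definition fibre_mx (K : numFieldType) (a b c d : K) : 'M[K]_3 :=
  \matrix_(i < 3) (if i == 0 then point3 1 0 0
                   else if i == 1 then point3 0 a b else point3 0 c d).

Lemma mul_fibre_mx (K : numFieldType) (a b c d : K) (x : 'rV[K]_3) :
  x *m fibre_mx a b c d =
  point3 (x 0 0) (x 0 1 * a + x 0 2 * c) (x 0 1 * b + x 0 2 * d).
Proof.
by apply: row3P; rewrite mxE sum3E !mxE /=; rewrite ?(mulr0, mulr1, add0r, addr0).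
Qed.

Lemma fibre_mx_fibrewise (K : numFieldType) (a b c d : K) :
  fibrewise (fibre_mx a b c d).
Proof.
move=> x; rewrite !mul_fibre_mx point3E; split=> // _.
by apply: row3P; rewrite !point3E //; ring.
Qed.

Lemma fibre_mxM (K : numFieldType) (a b c d a' b' c' d' : K) :
  fibre_mx a b c d *m fibre_mx a' b' c' d' =
  fibre_mx (a * a' + b * c') (a * b' + b * d') (c * a' + d * c') (c * b' + d * d').
Proof.
apply/matrixP => i j; rewrite !mxE sum3E !mxE.
by elim/ord3P: i; elim/ord3P: j; rewrite /= ?mxE /=; ring.
Qed.

Lemma fibre_mx1 (K : numFieldType) : fibre_mx 1 0 0 1 = 1%:M :> 'M[K]_3.
Proof.
by apply/matrixP => i j; elim/ord3P: i; elim/ord3P: j; rewrite !mxE /= ?mxE.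
Qed.

(** [fibre_mx 0 1 (-1) 0] is the rotation (u_1, u_2) |-> (- u_2, u_1), and
    [fibre_mx 1 0 0 (-1)] the reflection u_2 |-> - u_2. *)
Lemma rotation_inv (K : numFieldType) :
  fibre_mx 0 1 (-1) 0 *m fibre_mx 0 (-1) 1 0 = 1%:M :> 'M[K]_3.
Proof. by rewrite fibre_mxM -fibre_mx1; congr fibre_mx; ring. Qed.

Lemma reflection_inv (K : numFieldType) :
  fibre_mx 1 0 0 (-1) *m fibre_mx 1 0 0 (-1) = 1%:M :> 'M[K]_3.
Proof. by rewrite fibre_mxM -fibre_mx1; congr fibre_mx; ring. Qed.

Lemma rotation_eU1 (K : numFieldType) (x : 'rV[K]_3) :
  let J := fibre_mx 0 1 (-1) 0 in J^T *m eU1 x *m J = eU2 (x *m J).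
Proof.
apply/matrixP => i j; rewrite !mxE !sum3E !mxE !sum3E !mxE /=.
by elim/ord3P: i; elim/ord3P: j; rewrite /= ?mxE /=; ring.
Qed.

Lemma rotation_eU3 (K : numFieldType) (x : 'rV[K]_3) :
  let J := fibre_mx 0 1 (-1) 0 in J^T *m eU3 x *m J = eU4 (x *m J).
Proof.
rewrite /= mul_fibre_mx; apply/matrixP => i j.
rewrite !mxE !sum3E !mxE !sum3E !mxE /=.
by elim/ord3P: i; elim/ord3P: j; rewrite /= ?mxE /=; ring.
Qed.

Lemma reflection_eU1 (K : numFieldType) (x : 'rV[K]_3) :
  let S := fibre_mx 1 0 0 (-1) in S^T *m eU1 x *m S = - eU1 (x *m S).
Proof.
apply/matrixP => i j; rewrite !mxE !sum3E !mxE !sum3E !mxE /=.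
by elim/ord3P: i; elim/ord3P: j; rewrite /= ?mxE /=; ring.
Qed.

Lemma reflection_eU3 (K : numFieldType) (x : 'rV[K]_3) :
  let S := fibre_mx 1 0 0 (-1) in S^T *m eU3 x *m S = - eU3 (x *m S).
Proof.
rewrite /= mul_fibre_mx; apply/matrixP => i j.
rewrite !mxE !sum3E !mxE !sum3E !mxE /=.
by elim/ord3P: i; elim/ord3P: j; rewrite /= ?mxE /=; ring.
Qed.

Lemma e1_e2 (K : numFieldType) : linearly_isomorphic (e1 K) (e2 K).
Proof.
exists false, (fibre_mx 0 1 (-1) 0), (fibre_mx 0 (-1) 1 0).
split; [exact: fibre_mx_fibrewise..|exact: rotation_inv|].
by case=> x /=; rewrite ?mulmxN ?mulNmx (rotation_eU1, rotation_eU3).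
Qed.

Lemma e3_e4 (K : numFieldType) : linearly_isomorphic (e3 K) (e4 K).
Proof.
exists false, (fibre_mx 0 1 (-1) 0), (fibre_mx 0 (-1) 1 0).
split; [exact: fibre_mx_fibrewise..|exact: rotation_inv|].
by case=> x /=; rewrite ?mulmxN ?mulNmx (rotation_eU1, rotation_eU3).
Qed.

(** Both charts contribute a sign: the reflection negates eU1 and eU3, and in
    the chart V the expressions of e_1 and e_3 are - eU3 and - eU1. *)
Lemma e1_e3 (K : numFieldType) : linearly_isomorphic (e1 K) (e3 K).
Proof.
exists true, (fibre_mx 1 0 0 (-1)), (fibre_mx 1 0 0 (-1)).
split; [exact: fibre_mx_fibrewise..|exact: reflection_inv|].
by case=> x /=; rewrite ?mulmxN ?mulNmx (reflection_eU1, reflection_eU3) ?opprK.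
Qed.

Lemma e1_e (K : numFieldType) (k : 'I_4) : linearly_isomorphic (e1 K) (e K k).
Proof.
have refl : linearly_isomorphic (e1 K) (e1 K).
  exact: linearly_isomorphic_trans (e1_e2 K) (linearly_isomorphic_sym (e1_e2 K)).
case: k => [[|[|[|[|//]]]] ltk]; rewrite /e (tnth_nth (e1 K)) /=.
- exact: refl.
- exact: e1_e2.
- exact: e1_e3.
- exact: linearly_isomorphic_trans (e1_e3 K) (e3_e4 K).
Qed.

Theorem theorem3p12 (R : realType) (k l : 'I_4) :
  poisson_isomorphic (e R[i] k) (e R[i] l).
Proof.
apply: linearly_isomorphicW.
exact: linearly_isomorphic_trans (linearly_isomorphic_sym (e1_e _ k)) (e1_e _ l).
Qed.
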